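(* For $\lambda\in[0,1]$ let $T_\lambda=\lambda W_3^+ + (1-\lambda)W_3^-$. Then for every $\lambda\in[1/4,1]$ and every integer $k\geq 2$, $T_\lambda^{\otimes k}\in\mathrm{conv}(\mathrm{Aut}(M_{3^k}(\mathbb{C})))$.
   Context: The Holevo–Werner channels on $M_3(\mathbb{C})$ are $W_3^+(x)=\frac{1}{4}(\mathrm{Tr}_3(x)1_3+x^t)$ and $W_3^-(x)=\frac{1}{2}(\mathrm{Tr}_3(x)1_3-x^t)$, where $\mathrm{Tr}_3$ is the non-normalized trace and $x^t$ the transpose. $T_\lambda^{\otimes k}$ acts on $M_3(\mathbb{C})^{\otimes k}$, identified with $M_{3^k}(\mathbb{C})$. $\mathrm{Aut}(M_m(\mathbb{C}))$ is the set of maps $x\mapsto u^*xu$ with $u\in M_m(\mathbb{C})$ unitary and $\mathrm{conv}$ denotes convex hull. *)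

(* Defs.v *)
(* complex numbers are R[i] for R : realType (mathcomp-real-closed complex). *)
From HB Require Import structures.
From mathcomp Require Import all_boot all_order all_algebra.
From mathcomp Require Import reals.
From mathcomp Require Import complex.
From mathcomp Require Import spectral sesquilinear.
Set Implicit Arguments. Unset Strict Implicit. Unset Printing Implicit Defensive.
Import Order.TTheory GRing.Theory Num.Theory.
Local Open Scope ring_scope.
Local Open Scope complex_scope.

(* Holevo–Werner channels on M_3(C):
   W3p x = 1/4 (Tr x 1 + x^t),  W3m x = 1/2 (Tr x 1 - x^t). *)
Definition W3p (C : fieldType) (x : 'M[C]_3) : 'M[C]_3 :=
  (4%:R)^-1 *: ((\tr x)%:M + x^T).
Definition W3m (C : fieldType) (x : 'M[C]_3) : 'M[C]_3 :=
  (2%:R)^-1 *: ((\tr x)%:M - x^T).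

(* T_lambda = lambda W3^+ + (1 - lambda) W3^- *)
Definition Tlam (R : realType) (l : R) (x : 'M[R[i]]_3) : 'M[R[i]]_3 :=
  (l%:C) *: W3p x + ((1 - l)%:C) *: W3m x.

(* l-th base-3 digit of a (least significant digit is l = 0).
   It identifies the index set 'I_(3^k) with ('I_3)^k. *)
Definition digit3 (a l : nat) : 'I_3 := inord ((a %/ 3 ^ l) %% 3).

(* k-fold tensor power of a linear map f on M_3, acting on
   M_3^{(x)k} = M_{3^k}: it is the linear map sending the matrix unit
   E_{ij} = E_{i_0 j_0} (x) ... (x) E_{i_(k-1) j_(k-1)} to
   f(E_{i_0 j_0}) (x) ... (x) f(E_{i_(k-1) j_(k-1)}). *)
Definition tensor_pow (C : comNzRingType) (f : 'M[C]_3 -> 'M[C]_3) (k : nat)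
  (X : 'M[C]_(3 ^ k)) : 'M[C]_(3 ^ k) :=
  \matrix_(a, b) \sum_(i < 3 ^ k) \sum_(j < 3 ^ k)
     (\prod_(l < k) f (delta_mx (digit3 i l) (digit3 j l)) (digit3 a l) (digit3 b l))
     * X i j.

(* Phi in conv(Aut(M_m(C))): a finite convex combination of maps x |-> u^* x u
   with u unitary. *)
Definition in_conv_Aut (R : realType) (m : nat) (Phi : 'M[R[i]]_m -> 'M[R[i]]_m) : Prop :=
  exists (N : nat) (p : 'I_N -> R) (u : 'I_N -> 'M[R[i]]_m),
    [/\ forall t, 0 <= p t,
        \sum_(t < N) p t = 1,
        forall t, u t \is unitarymx
      & forall x, Phi x = \sum_(t < N) (p t)%:C *: (((u t)^t*)%sesqui *m x *m u t)].
Arguments tensor_pow {C} f k X.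
Arguments in_conv_Aut {R} m Phi.

(* Main.v *)
(* A map of the form X |-> sum K a b i j * X i j is handled through its kernel K;
   conjugation by u has kernel conj (u i a) * u j b.  Twirling such a kernel in
   each tensor factor by a finite weighted unitary 2-design of C^3, u being
   replaced by (g (x) h)^t u (g (x) h), projects it onto the span of the products of
   delta = [a = b][i = j] and theta = [a = j][i = b], that is, onto tensor products
   of W^+ and W^-, with coefficients read off the inner products of u with its
   partial transposes.  Explicit unitaries give in this way, for one factor,
     1                               : W^+ ,
     a quarter turn about an axis    : B = (1/3) W^+ + (2/3) W^- = T_(1/3),
   and for two factors
     (2/3) sum E_ij (x) E_ij - flip  : A = (2/27) W^+W^+ + (25/27) W^-W^- ,
     a monomial matrix with cube roots of unity as entries and no component in
     Sym (x) Sym                     : D = (1/3) (W^+W^- + W^-W^+ + W^-W^-).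
   For 1/3 <= l <= 1 the map T_l itself is a mixture of W^+ and B.  For
   1/4 <= l <= 1/3 and e = 1 - 3 l,
     T_l^2 = (9 e / 7) A + (9 l^2 - 6 e / 7) B^2 + e (3 l + 4/7) D,
     T_l^3 = (9/14) e (3 + e^2) BA + ((1 - e)^3 - (3/7) e (3 + e^2)) B^3
             + e (33/14 - 3 e + (2/7) e^2) BD + (e^3 / 2) W^+D,
   the mixed terms of the cube being averaged over the positions of the single
   factor; all weights are nonnegative, and k >= 2 is a sum of twos and threes. *)
Require Import Defs.
From HB Require Import structures.
From mathcomp Require Import all_boot all_order all_algebra.
From mathcomp Require Import reals complex.
From mathcomp Require Import spectral sesquilinear.
From mathcomp Require Import ring lra.
Set Implicit Arguments. Unset Strict Implicit. Unset Printing Implicit Defensive.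
Import Order.TTheory GRing.Theory Num.Theory.
Local Open Scope ring_scope.

(** * The cone of unitary mixtures *)

Section Kernels.
Variable C : numClosedFieldType.

(** Only columns are tested: the matrix is square, so this is unitarity. Arbitrary finite index
    types make tensor products and reindexing free of casts. *)
Definition isometric (I : finType) (u : I -> I -> C) : Prop :=
  forall a b, \sum_i (u i a)^* * u i b = (a == b)%:R.

(** The total weight [c] is left free so that mixtures can be built by adding and scaling; [ucone 1]
    is the convex hull itself. *)
Definition ucone (I : finType) (c : C) (K : I -> I -> I -> I -> C) : Prop :=
  exists (T : finType) (p : T -> C) (u : T -> I -> I -> C),
    [/\ forall t, 0 <= p t, \sum_t p t = c, forall t, isometric (u t)
      & forall a b i j, K a b i j = \sum_t p t * ((u t i a)^* * u t j b)].

Lemma ucone_ext (I : finType) c c' (K L : I -> I -> I -> I -> C) :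
  c = c' -> (forall a b i j, K a b i j = L a b i j) -> ucone c K -> ucone c' L.
Proof.
move=> <- eKL [T [p [u [p0 p1 uu eK]]]]; exists T, p, u; split=> // a b i j.
by rewrite -eKL eK.
Qed.

Lemma uconeD (I : finType) c d (K L : I -> I -> I -> I -> C) :
  ucone c K -> ucone d L -> ucone (c + d) (fun a b i j => K a b i j + L a b i j).
Proof.
move=> [T [p [u [p0 p1 uu eK]]]] [S [q [v [q0 q1 vv eL]]]].
exists (T + S)%type, (fun x => match x with inl t => p t | inr s => q s end),
  (fun x => match x with inl t => u t | inr s => v s end); split.
- by case.
- by rewrite big_sumType p1 q1.
- by case.
- by move=> a b i j; rewrite big_sumType eK eL.
Qed.

Lemma uconeZ (I : finType) x c (K : I -> I -> I -> I -> C) :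
  0 <= x -> ucone c K -> ucone (x * c) (fun a b i j => x * K a b i j).
Proof.
move=> x0 [T [p [u [p0 p1 uu eK]]]]; exists T, (fun t => x * p t), u; split=> //.
- by move=> t; rewrite mulr_ge0.
- by rewrite -mulr_sumr p1.
- by move=> a b i j; rewrite eK mulr_sumr; apply: eq_bigr => t _; rewrite -mulrA.
Qed.

Lemma ucone_reindex (I J : finType) (f : I -> J) c (K : J -> J -> J -> J -> C) :
  bijective f -> ucone c K ->
  ucone c (fun a b i j => K (f a) (f b) (f i) (f j)).
Proof.
move=> bf [T [p [u [p0 p1 uu eK]]]].
exists T, p, (fun t i j => u t (f i) (f j)); split=> // t a b.
have [g fK gK] := bf.
rewrite -(inj_eq (bij_inj bf)) -(uu t) (reindex f) //.
by exists g => ? _.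
Qed.

Lemma isometric_tensor (I J : finType) (u : I -> I -> C) (v : J -> J -> C) :
  isometric u -> isometric v ->
  isometric (fun i j : I * J => u i.1 j.1 * v i.2 j.2).
Proof.
move=> uu vv a b; rewrite -pair_eqE /pair_eq /= -mulnb natrM.
rewrite -uu -vv big_distrlr pair_big /=.
by apply: eq_bigr => i _; rewrite rmorphM /=; ring.
Qed.

Lemma ucone_tensor (I J : finType) c d (K : I -> I -> I -> I -> C)
    (L : J -> J -> J -> J -> C) :
  ucone c K -> ucone d L ->
  ucone (c * d) (fun a b i j : I * J =>
    K a.1 b.1 i.1 j.1 * L a.2 b.2 i.2 j.2).
Proof.
move=> [T [p [u [p0 p1 uu eK]]]] [S [q [v [q0 q1 vv eL]]]].
exists (T * S)%type, (fun x => p x.1 * q x.2),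
  (fun x i j => u x.1 i.1 j.1 * v x.2 i.2 j.2); split.
- by move=> x; rewrite mulr_ge0.
- by rewrite -p1 -q1 big_distrlr pair_big.
- by move=> x; apply: isometric_tensor.
- move=> a b i j; rewrite eK eL big_distrlr pair_big /=.
  by apply: eq_bigr => x _; rewrite rmorphM /=; ring.
Qed.

Definition fun_mulmx (I : finType) (u v : I -> I -> C) i j := \sum_k u i k * v k j.

Lemma isometric_mulmx (I : finType) (u v : I -> I -> C) :
  isometric u -> isometric v -> isometric (fun_mulmx u v).
Proof.
move=> uu vv a b; rewrite /fun_mulmx.
under eq_bigr => i _ do rewrite rmorph_sum /= big_distrlr /=.
rewrite exchange_big /= -(vv a b); apply: eq_bigr => k _.
rewrite exchange_big /= (bigD1 k) //= [X in _ + X]big1 ?addr0.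
  rewrite (eq_bigr (fun i => ((u i k)^* * u i k) * ((v k a)^* * v k b))).
    by rewrite -mulr_suml uu eqxx mul1r.
  by move=> i _; rewrite rmorphM /=; ring.
move=> l lk; rewrite (eq_bigr (fun i => ((u i k)^* * u i l) * ((v k a)^* * v l b))).
  by rewrite -mulr_suml uu eq_sym (negPf lk) mul0r.
by move=> i _; rewrite rmorphM /=; ring.
Qed.

(** The mixed unitaries are g^t v g. Expanding them gathers all dependence on [s] into a fourth
    moment of g, which a 2-design makes explicit. *)
Lemma ucone_twirl (I S : finType) (q : S -> C) (g : S -> I -> I -> C)
    (v : I -> I -> C) :
  (forall s, 0 <= q s) -> (forall s, isometric (g s)) ->
  (forall s, isometric (fun i j => g s j i)) -> isometric v ->
  ucone (\sum_s q s) (fun a b i j => \sum_i' \sum_a' \sum_j' \sum_b'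
    (\sum_s q s * ((g s i' i)^* * (g s a' a)^* * g s j' j * g s b' b)) *
      ((v i' a')^* * v j' b')).
Proof.
move=> q0 gg gtg vv.
exists S, q, (fun s => fun_mulmx (fun_mulmx (fun i j => g s j i) v) (g s)); split=> //.
  by move=> s; do 2?apply: isometric_mulmx.
move=> a b i j; rewrite /fun_mulmx.
have expand s x y : \sum_k (\sum_l g s l x * v l k) * g s k y =
    \sum_l \sum_k g s l x * v l k * g s k y.
  by rewrite exchange_big /=; apply: eq_bigr => k _; rewrite mulr_suml.
have prodE (f h : I -> I -> C) : (\sum_x \sum_y f x y)^* * (\sum_z \sum_w h z w) =
    \sum_x \sum_y \sum_z \sum_w (f x y)^* * h z w.
  rewrite rmorph_sum mulr_suml; apply: eq_bigr => x _.
  rewrite rmorph_sum mulr_suml; apply: eq_bigr => y _.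
  by rewrite mulr_sumr; apply: eq_bigr => z _; rewrite mulr_sumr.
under [RHS]eq_bigr => s _.
  rewrite !expand prodE mulr_sumr.
  under eq_bigr => i' _.
    rewrite mulr_sumr.
    under eq_bigr => a' _.
      rewrite mulr_sumr.
      under eq_bigr => j' _ do rewrite mulr_sumr.
      over.
    over.
  over.
rewrite [RHS]exchange_big /=; apply: eq_bigr => i' _.
rewrite [RHS]exchange_big /=; apply: eq_bigr => a' _.
rewrite [RHS]exchange_big /=; apply: eq_bigr => j' _.
rewrite [RHS]exchange_big /=; apply: eq_bigr => b' _.
rewrite mulr_suml; apply: eq_bigr => s _.
rewrite !rmorphM /=; ring.
Qed.

End Kernels.

(** * A unitary 2-design in dimension three *)

Lemma sum_ord3 (V : nmodType) (F : nat -> V) : \sum_(i < 3) F i = F 0%N + F 1%N + F 2%N.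
Proof. by rewrite !big_ord_recr /= big_ord0 GRing.add0r. Qed.

(** Equality of the multisets {i, a} and {j, b}: the condition under which diagonal phases
    cancel. *)
Definition crossing (i a j b : nat) : bool :=
  ((i == j) && (a == b)) || ((i == b) && (a == j)).

(* Three times an entry of P (p = true) or (1 - (2/3) J) P (p = false), where J is
   the all-ones matrix and P runs over the six permutation matrices as c and s vary.
   With the weights 5 and 27 below, x^4 has mean 1/6 for every entry x, the value
   for a 2-design. *)
Definition mono3 (c : nat) (s p : bool) (x y : nat) : int :=
  let hit := y == ((if s then c + x else c + 3 - x) %% 3)%N in
  if p then (if hit then 3 else 0) else (if hit then 1 else -2).

Definition mono_wt (p : bool) : int := if p then 5 else 27.

(** Unrolled over naturals, so that [vm_compute] meets no big operator. *)
Definition sum_mono (F : nat -> bool -> bool -> int) : int :=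
  let G c := F c true true + F c true false + (F c false true + F c false false) in
  G 0%N + G 1%N + G 2%N.

Lemma sum_monoE (F : nat -> bool -> bool -> int) :
  \sum_(t : 'I_3 * bool * bool) F t.1.1 t.1.2 t.2 = sum_mono F.
Proof.
rewrite -(pair_bigA _ (fun (x : 'I_3 * bool) y => F x.1 x.2 y)) /=.
rewrite -(pair_bigA _ (fun (x : 'I_3) y => \sum_z F x y z)) /=.
rewrite (sum_ord3 (fun x => \sum_y \sum_z F x y z)) /sum_mono.
by rewrite !big_bool.
Qed.

Lemma mono3_col c s p a b : (c < 3)%N -> (a < 3)%N -> (b < 3)%N ->
  \sum_(i < 3) mono3 c s p i a * mono3 c s p i b = (9 * (a == b))%:Z.
Proof.
rewrite (sum_ord3 (fun i => mono3 c s p i a * mono3 c s p i b)).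
by case: c => [|[|[]]] //; case: s; case: p; case: a => [|[|[]]] //;
   case: b => [|[|[]]].
Qed.

Lemma mono3_row c s p a b : (c < 3)%N -> (a < 3)%N -> (b < 3)%N ->
  \sum_(i < 3) mono3 c s p a i * mono3 c s p b i = (9 * (a == b))%:Z.
Proof.
rewrite (sum_ord3 (fun i => mono3 c s p a i * mono3 c s p b i)).
by case: c => [|[|[]]] //; case: s; case: p; case: a => [|[|[]]] //;
   case: b => [|[|[]]].
Qed.

(* 24 times the Haar average of conj(g i' i) conj(g a' a) (g j' j) (g b' b) on U(3). *)
Definition weingarten (i' a' j' b' i a j b : nat) : int :=
  (3 * ((i' == j') && (a' == b'))%:Z - ((a' == j') && (i' == b'))%:Z)
    * ((i == j) && (a == b))%:Z +
  (3 * ((a' == j') && (i' == b'))%:Z - ((i' == j') && (a' == b'))%:Z)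
    * ((a == j) && (i == b))%:Z.

(* The crossing conditions come from averaging over diagonal phases on both sides;
   648 = 192 * 81 / 24, with 192 the total weight and 81 the scaling of [mono3]. *)
Lemma sum_mono_weingarten (i' a' j' b' i a j b : 'I_3) :
  (crossing i' a' j' b' && crossing i a j b)%:Z *
   sum_mono (fun c s p => mono_wt p * (mono3 c s p i' i * mono3 c s p a' a *
      mono3 c s p j' j * mono3 c s p b' b)) = 648 * weingarten i' a' j' b' i a j b.
Proof.
pose chk i' a' j' b' i a j b :=
  (crossing i' a' j' b' && crossing i a j b)%:Z *
   sum_mono (fun c s p => mono_wt p * (mono3 c s p i' i * mono3 c s p a' a *
      mono3 c s p j' j * mono3 c s p b' b)) == 648 * weingarten i' a' j' b' i a j b.
pose A P := all P (iota 0 3).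
have mem (x : 'I_3) : (x : nat) \in iota 0 3 by rewrite mem_iota ltn_ord.
(* All 3^8 index patterns are checked by integer computation. *)
have : A (fun i' => A (fun a' => A (fun j' => A (fun b' =>
         A (fun i => A (fun a => A (fun j => A (chk i' a' j' b' i a j)))))))).
  by vm_compute.
move=> /allP/(_ _ (mem i')) /allP/(_ _ (mem a')) /allP/(_ _ (mem j')).
move=> /allP/(_ _ (mem b')) /allP/(_ _ (mem i)) /allP/(_ _ (mem a)).
move=> /allP/(_ _ (mem j)) /allP/(_ _ (mem b)).
by move/eqP.
Qed.

Section Design.
Variable C : numClosedFieldType.

Lemma cube_root_unity : exists w : C, w ^+ 2 + w + 1 = 0 /\ w^* = w ^+ 2.
Proof.
have s3 : sqrtC 3 ^+ 2 = 3 :> C by rewrite sqrtCK.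
have i2 : 'i ^+ 2 = -1 :> C by rewrite sqrCi.
exists ((-1 + 'i * sqrtC 3) / 2); split.
  have -> : ((-1 + 'i * sqrtC 3) / 2) ^+ 2 + (-1 + 'i * sqrtC 3) / 2 + 1 =
    ('i ^+ 2 * sqrtC 3 ^+ 2 + 3) / 4 :> C by field.
  by rewrite s3 i2 mulN1r addNr mul0r.
rewrite rmorphM rmorphD rmorphN rmorphM /= conjCi rmorph1 fmorphV rmorph_nat /=.
have -> : (sqrtC 3)^* = sqrtC 3 :> C by rewrite geC0_conj // sqrtC_ge0 ler0n.
have -> : ((-1 + 'i * sqrtC 3) / 2) ^+ 2 =
    (1 - 2 * 'i * sqrtC 3 + 'i ^+ 2 * sqrtC 3 ^+ 2) / 4 :> C by field.
by rewrite s3 i2; field.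
Qed.

Variable w : C.
Hypothesis w_root : w ^+ 2 + w + 1 = 0.
Hypothesis w_conj : w^* = w ^+ 2.

Lemma cube_root3 : w ^+ 3 = 1.
Proof.
apply/eqP; rewrite -subr_eq0.
have -> : w ^+ 3 - 1 = (w - 1) * (w ^+ 2 + w + 1) by ring.
by rewrite w_root mulr0.
Qed.

Lemma cube_root_unit n : (w ^+ n)^* * w ^+ n = 1.
Proof. by rewrite rmorphXn /= w_conj -exprM -exprD -mulSnr exprM cube_root3 expr1n. Qed.

(** Orthogonality of the characters of Z/3. *)
Lemma sum_cube_root n : \sum_(r < 3) w ^+ (r * n) = ((n %% 3 == 0) * 3)%N%:R.
Proof.
rewrite (sum_ord3 (fun r => w ^+ (r * n))) mul0n mul1n expr0.
have -> : w ^+ n = w ^+ (n %% 3).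
  by rewrite {1}(divn_eq n 3) exprD mulnC exprM cube_root3 expr1n mul1r.
have -> : w ^+ (2 * n) = w ^+ (2 * (n %% 3)).
  by rewrite {1}(divn_eq n 3) mulnDr exprD mulnA mulnC exprM cube_root3 expr1n mul1r.
have : (n %% 3 < 3)%N by rewrite ltn_mod.
case: (n %% 3)%N => [|[|[]]] //= _; first by rewrite muln0 expr0; ring.
  by rewrite muln1 expr1 -[RHS]/(0 : C) -w_root; ring.
have -> : w ^+ (2 * 2) = w by rewrite exprS cube_root3 mulr1.
by rewrite -[RHS]/(0 : C) -w_root; ring.
Qed.

Definition phase (x : {ffun 'I_3 -> 'I_3}) (i : 'I_3) : C := w ^+ (x i).

(** The sum factors over coordinates. Conjugation doubles exponents, so [n l] is [l = j] + [l = b] -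
    [l = i] - [l = a] modulo 3. This difference lies between -2 and 2, hence vanishes modulo 3 only
    if it is zero; so cube roots of unity suffice as phases. *)
Lemma phase_avg (i a j b : 'I_3) :
  \sum_x ((phase x i)^* * (phase x a)^* * phase x j * phase x b) =
  27 * (crossing i a j b)%:R.
Proof.
pose n (l : 'I_3) := (2 * ((l == i) + (l == a)) + (l == j) + (l == b))%N.
have phaseE x k : phase x k = \prod_l w ^+ (x l * (l == k)).
  rewrite (bigD1 k) //= eqxx muln1 big1 ?mulr1 // => l /negPf ->.
  by rewrite muln0 expr0.
have phaseC x k : (phase x k)^* = \prod_l w ^+ (x l * (2 * (l == k))).
  rewrite phaseE rmorph_prod; apply: eq_bigr => l _.
  by rewrite rmorphXn /= w_conj -exprM mulnCA.
rewrite (eq_bigr (fun x : {ffun 'I_3 -> 'I_3} => \prod_l w ^+ (x l * n l))).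
  rewrite -(bigA_distr_bigA (fun (l r : 'I_3) => w ^+ (r * n l))).
  under eq_bigr => l _ do rewrite sum_cube_root.
  rewrite -natr_prod -natrM; congr (_ %:R); rewrite /n {n}.
  rewrite !big_ord_recl big_ord0.
  by case: i => [[|[|[]]]] //; case: a => [[|[|[]]]] //;
    case: j => [[|[|[]]]] //; case: b => [[|[|[]]]].
move=> x _; rewrite !phaseC !phaseE -!big_split; apply: eq_bigr => l _ /=.
by rewrite -!exprD -!mulnDr.
Qed.

Definition monoC (t : 'I_3 * bool * bool) (i j : 'I_3) : C :=
  (mono3 t.1.1 t.1.2 t.2 i j)%:~R / 3.

Definition design_index : finType :=
  ({ffun 'I_3 -> 'I_3} * ('I_3 * bool * bool) * {ffun 'I_3 -> 'I_3})%type.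

Definition design (s : design_index) (i j : 'I_3) : C :=
  phase s.1.1 i * monoC s.1.2 i j * phase s.2 j.

Definition design_wt (s : design_index) : C :=
  (mono_wt s.1.2.2)%:~R / (192 * 27 * 27).

Lemma monoC_conj t i j : (monoC t i j)^* = monoC t i j.
Proof. by rewrite /monoC rmorphM fmorphV rmorph_nat rmorph_int. Qed.

Lemma design_conj s i j :
  (design s i j)^* = (phase s.1.1 i)^* * monoC s.1.2 i j * (phase s.2 j)^*.
Proof. by rewrite /design 2!rmorphM /= monoC_conj. Qed.

Lemma design_iso s : isometric (design s).
Proof.
case: s => [[x [[c s] p]] y] a b.
rewrite (eq_bigr (fun i : 'I_3 => ((phase y a)^* * phase y b / 9) *
    (mono3 c s p i a * mono3 c s p i b)%:~R)).
  rewrite -mulr_sumr -rmorph_sum /= mono3_col //.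
  rewrite -(inj_eq val_inj); case: (a =P b) => [->|/eqP]; last first.
    by rewrite -(inj_eq val_inj) => /negPf ->; rewrite muln0 mulr0.
  by rewrite eqxx cube_root_unit mul1r muln1 -pmulrn mulVf // pnatr_eq0.
move=> i _; rewrite -[RHS]mul1r.
rewrite -[X in _ = X * _](cube_root_unit (x i)) -/(phase x i).
by rewrite design_conj /design /monoC /= intrM; field.
Qed.

Lemma design_tr_iso s : isometric (fun i j => design s j i).
Proof.
case: s => [[x [[c s] p]] y] a b.
rewrite (eq_bigr (fun i : 'I_3 => ((phase x a)^* * phase x b / 9) *
    (mono3 c s p a i * mono3 c s p b i)%:~R)).
  rewrite -mulr_sumr -rmorph_sum /= mono3_row //.
  rewrite -(inj_eq val_inj); case: (a =P b) => [->|/eqP]; last first.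
    by rewrite -(inj_eq val_inj) => /negPf ->; rewrite muln0 mulr0.
  by rewrite eqxx cube_root_unit mul1r muln1 -pmulrn mulVf // pnatr_eq0.
move=> i _; rewrite -[RHS]mul1r.
rewrite -[X in _ = X * _](cube_root_unit (y i)) -/(phase y i).
by rewrite design_conj /design /monoC /= intrM; field.
Qed.

(** The left and right phases average independently to the two crossing indicators, leaving the
    integer sum over [mono3] already tabulated. *)
Lemma design_weingarten (i' a' j' b' i a j b : 'I_3) :
  \sum_s design_wt s * ((design s i' i)^* * (design s a' a)^* * design s j' j * design s b' b) =
  (weingarten i' a' j' b' i a j b)%:~R / 24.
Proof.
pose ph x (i a j b : 'I_3) := (phase x i)^* * (phase x a)^* * phase x j * phase x b.
pose F (t : 'I_3 * bool * bool) := (mono_wt t.2 * (mono3 t.1.1 t.1.2 t.2 i' i *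
   mono3 t.1.1 t.1.2 t.2 a' a * mono3 t.1.1 t.1.2 t.2 j' j *
   mono3 t.1.1 t.1.2 t.2 b' b))%:~R / (192 * 27 * 27 * 81) : C.
transitivity (\sum_x \sum_t \sum_y ph x i' a' j' b' * F t * ph y i a j b).
  rewrite pair_bigA pair_bigA; apply: eq_bigr => -[[x t] y] _ /=.
  by rewrite !design_conj /F /ph /design /design_wt /= !intrM /monoC /=; field.
under eq_bigr => x _ do under eq_bigr => t _ do rewrite -mulr_sumr phase_avg.
under eq_bigr => x _ do rewrite -mulr_suml -mulr_sumr.
rewrite -!mulr_suml phase_avg.
rewrite -rmorph_sum /=.
rewrite (sum_monoE (fun c s p => mono_wt p * (mono3 c s p i' i *
   mono3 c s p a' a * mono3 c s p j' j * mono3 c s p b' b))).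
have /(congr1 (intr : int -> C)) := sum_mono_weingarten i' a' j' b' i a j b.
set S := sum_mono _; rewrite !intrM -mulnb PoszM intrM -!pmulrn => H.
have -> : (weingarten i' a' j' b' i a j b)%:~R =
    (648%:~R : C)^-1 * (648%:~R * (weingarten i' a' j' b' i a j b)%:~R) :> C.
  by rewrite mulKf // pnatr_eq0.
by rewrite -H -!pmulrn; field.
Qed.

Lemma design_wt_ge0 s : 0 <= design_wt s.
Proof.
rewrite /design_wt /mono_wt.
by case: ifP => _; rewrite divr_ge0 // ?ler0n // !mulr_ge0 // ler0n.
Qed.

(** Read off from the fourth moments: with j' = i' and b' = a' summed out, orthonormal columns make
    every design element contribute exactly its weight. *)
Lemma design_wt_sum : \sum_s design_wt s = 1.
Proof.
pose i : 'I_3 := ord0; pose j : 'I_3 := ord_max.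
transitivity (\sum_(i' < 3) \sum_(a' < 3) (weingarten i' a' i' a' i j i j)%:~R / 24 : C).
  under [RHS]eq_bigr => i' _ do under eq_bigr => a' _ do rewrite -design_weingarten.
  under [RHS]eq_bigr => i' _ do rewrite exchange_big.
  rewrite exchange_big /=; apply: eq_bigr => s _.
  transitivity (design_wt s * ((\sum_i' (design s i' i)^* * design s i' i) *
      (\sum_a' (design s a' j)^* * design s a' j))).
    by rewrite !design_iso !eqxx !mulr1.
  rewrite big_distrlr mulr_sumr; apply: eq_bigr => i' _.
  by rewrite mulr_sumr; apply: eq_bigr => a' _ => /=; ring.
under eq_bigr => i' _ do rewrite -mulr_suml -rmorph_sum.
rewrite -mulr_suml -rmorph_sum /=.
have -> : \sum_(i' < 3) \sum_(a' < 3) weingarten i' a' i' a' i j i j = 24.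
  by rewrite !big_ord_recl !big_ord0.
by rewrite -pmulrn divff // pnatr_eq0.
Qed.

End Design.

(** * Twirling one and two tensor factors *)

Section Bodies.
Variable C : numClosedFieldType.

(** The kernels of X -> Tr(X) 1 and, next, of X -> X^t. *)
Definition delta_ker (a b i j : 'I_3) : C := ((i == j) && (a == b))%:R.
Definition theta_ker (a b i j : 'I_3) : C := ((a == j) && (i == b))%:R.
(** [delta_coef] and [theta_coef] form the dual basis of [delta_ker], [theta_ker] for the entrywise
    pairing, whose Gram matrix has 9 on and 3 off the diagonal. *)
Definition delta_coef a b i j : C := (3 * delta_ker a b i j - theta_ker a b i j) / 24.
Definition theta_coef a b i j : C := (3 * theta_ker a b i j - delta_ker a b i j) / 24.

Lemma weingartenE (i' a' j' b' i a j b : 'I_3) :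
  (weingarten i' a' j' b' i a j b)%:~R / 24 =
  ((i' == j') && (a' == b'))%:R * delta_coef a b i j +
  ((a' == j') && (i' == b'))%:R * theta_coef a b i j :> C.
Proof.
rewrite /weingarten /delta_coef /theta_coef /delta_ker /theta_ker -!(inj_eq val_inj) /=.
by do 4!case: (_ && _) => /=; field.
Qed.

Lemma weingarten_collapse (i' a' i a j b : 'I_3) (F : 'I_3 -> 'I_3 -> C) :
  \sum_(j' < 3) \sum_(b' < 3) (weingarten i' a' j' b' i a j b)%:~R / 24 * F j' b' =
  delta_coef a b i j * F i' a' + theta_coef a b i j * F a' i'.
Proof.
under eq_bigr => j' _ do under eq_bigr => b' _ do rewrite weingartenE mulrDl.
under eq_bigr => j' _ do rewrite big_split.
rewrite big_split /=; congr (_ + _).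
  rewrite (bigD1 i') //= [X in _ + X]big1 ?addr0; last first.
    by move=> j' /negPf; rewrite eq_sym => ->; apply: big1 => b' _; rewrite !mul0r.
  rewrite (bigD1 a') //= big1 ?addr0 ?eqxx ?mul1r //.
  by move=> b' /negPf; rewrite eq_sym andbC => ->; rewrite !mul0r.
rewrite (bigD1 a') //= [X in _ + X]big1 ?addr0; last first.
  by move=> j' /negPf; rewrite eq_sym => ->; apply: big1 => b' _; rewrite !mul0r.
rewrite (bigD1 i') //= big1 ?addr0 ?eqxx ?mul1r //.
by move=> b' /negPf; rewrite eq_sym andbC => ->; rewrite !mul0r.
Qed.

Lemma ucone_twirl1 (v : 'I_3 -> 'I_3 -> C) : isometric v ->
  ucone 1 (fun a b i j =>
    (\sum_i' \sum_a' (v i' a')^* * v i' a') * delta_coef a b i j +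
    (\sum_i' \sum_a' (v i' a')^* * v a' i') * theta_coef a b i j).
Proof.
have [w [w1 w2]] := cube_root_unity C => vv.
apply: (ucone_ext _ _ (ucone_twirl (design_wt_ge0 C) (design_iso w1 w2) (design_tr_iso w1 w2) vv)).
  exact: design_wt_sum w1 w2.
move=> a b i j; rewrite !mulr_suml -big_split; apply: eq_bigr => i' _ /=.
rewrite !mulr_suml -big_split; apply: eq_bigr => a' _ /=.
under eq_bigr => j' _ do under eq_bigr => b' _ do rewrite design_weingarten //.
rewrite (weingarten_collapse i' a' i a j b (fun j' b' => (v i' a')^* * v j' b')).
by ring.
Qed.

(** Twirling by independent designs on the factors applies the one-factor formula twice. The
    coefficients pair v with itself, its two partial transposes and its transpose. *)
Lemma ucone_twirl2 (v : 'I_3 * 'I_3 -> 'I_3 * 'I_3 -> C) : isometric v ->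
  ucone 1 (fun a b i j =>
    (\sum_i' \sum_a' (v i' a')^* * v i' a') *
       (delta_coef a.1 b.1 i.1 j.1 * delta_coef a.2 b.2 i.2 j.2) +
    (\sum_i' \sum_a' (v i' a')^* * v (a'.1, i'.2) (i'.1, a'.2)) *
       (theta_coef a.1 b.1 i.1 j.1 * delta_coef a.2 b.2 i.2 j.2) +
    (\sum_i' \sum_a' (v i' a')^* * v (i'.1, a'.2) (a'.1, i'.2)) *
       (delta_coef a.1 b.1 i.1 j.1 * theta_coef a.2 b.2 i.2 j.2) +
    (\sum_i' \sum_a' (v i' a')^* * v a' i') *
       (theta_coef a.1 b.1 i.1 j.1 * theta_coef a.2 b.2 i.2 j.2)).
Proof.
have [w [w1 w2]] := cube_root_unity C => vv.
pose q (s : design_index * design_index) : C := design_wt C s.1 * design_wt C s.2.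
pose g (s : design_index * design_index) (i j : 'I_3 * 'I_3) : C :=
  design w s.1 i.1 j.1 * design w s.2 i.2 j.2.
have q0 s : 0 <= q s by rewrite mulr_ge0 ?design_wt_ge0.
have gi s : isometric (g s) by apply: isometric_tensor; apply: design_iso.
have gti s : isometric (fun i j => g s j i).
  by apply: (isometric_tensor (u := fun i j => design w s.1 j i)
    (v := fun i j => design w s.2 j i)); apply: design_tr_iso.
apply: (ucone_ext _ _ (ucone_twirl q0 gi gti vv)).
  rewrite -(pair_bigA _ (fun s t : design_index => design_wt C s * design_wt C t)) /=.
  under eq_bigr => s _ do rewrite -mulr_sumr (design_wt_sum w1 w2).
  by rewrite -mulr_suml (design_wt_sum w1 w2) mulr1.
move=> a b i j; rewrite !mulr_suml -!big_split; apply: eq_bigr => i' _ /=.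
rewrite !mulr_suml -!big_split; apply: eq_bigr => a' _ /=.
pose W1 (j1 b1 : 'I_3) : C := (weingarten i'.1 a'.1 j1 b1 i.1 a.1 j.1 b.1)%:~R / 24.
pose W2 (j2 b2 : 'I_3) : C := (weingarten i'.2 a'.2 j2 b2 i.2 a.2 j.2 b.2)%:~R / 24.
(* Sums over pairs are separated so that the second factor collapses first, inside the first. *)
transitivity (\sum_(j1 < 3) \sum_(b1 < 3) W1 j1 b1 *
    (\sum_(j2 < 3) \sum_(b2 < 3) W2 j2 b2 * ((v i' a')^* * v (j1, j2) (b1, b2)))).
  transitivity (\sum_(j' : 'I_3 * 'I_3) \sum_(b' : 'I_3 * 'I_3)
      W1 j'.1 b'.1 * (W2 j'.2 b'.2 *
        ((v i' a')^* * v (j'.1, j'.2) (b'.1, b'.2)))).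
    apply: eq_bigr => -[j1 j2] _; apply: eq_bigr => -[b1 b2] _ /=.
    rewrite [RHS]mulrA; congr (_ * _); rewrite /W1 /W2.
    rewrite -(design_weingarten w1 w2) -(design_weingarten w1 w2).
    rewrite big_distrlr pair_bigA; apply: eq_bigr => s _.
    by rewrite /q /g !rmorphM /=; ring.
  rewrite -(pair_bigA _ (fun j1 j2 => \sum_(b' : 'I_3 * 'I_3)
      W1 j1 b'.1 * (W2 j2 b'.2 * ((v i' a')^* * v (j1, j2) (b'.1, b'.2))))) /=.
    apply: eq_bigr => j1 _.
    under eq_bigr => j2 _.
      rewrite -(pair_bigA _ (fun b1 b2 =>
        W1 j1 b1 * (W2 j2 b2 * ((v i' a')^* * v (j1, j2) (b1, b2))))) /=.
      over.
    rewrite exchange_big /=; apply: eq_bigr => b1 _.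
    rewrite mulr_sumr; apply: eq_bigr => j2 _.
    by rewrite mulr_sumr.
under eq_bigr => j1 _ do under eq_bigr => b1 _ do
  rewrite (weingarten_collapse i'.2 a'.2 i.2 a.2 j.2 b.2
    (fun j2 b2 => (v i' a')^* * v (j1, j2) (b1, b2))).
rewrite (weingarten_collapse i'.1 a'.1 i.1 a.1 j.1 b.1 (fun j1 b1 =>
  delta_coef a.2 b.2 i.2 j.2 * ((v i' a')^* * v (j1, i'.2) (b1, a'.2)) +
  theta_coef a.2 b.2 i.2 j.2 * ((v i' a')^* * v (j1, a'.2) (b1, i'.2)))).
by case: i' {W1 W2} => i1 i2; case: a' => a1 a2 /=; ring.
Qed.

End Bodies.

(** * Explicit unitaries *)

Section Examples.
Variable C : numClosedFieldType.

(** The channel T_l regrouped by trace part and transpose part. *)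
Definition Tlam_ker (l : C) (a b i j : 'I_3) : C :=
  (2 - l) / 4 * delta_ker C a b i j + (3 * l - 2) / 4 * theta_ker C a b i j.

Lemma isometric_monomial (I : finType) (s : I -> I) (c : I -> C) :
  injective s -> (forall i, (c i)^* * c i = 1) ->
  isometric (fun i a => (a == s i)%:R * c i).
Proof.
move=> s_inj c1 a b; have [t sK tK] := injF_bij s_inj.
rewrite (bigD1 (t a)) //= tK eqxx big1 ?addr0 => [|i /negPf ti].
  by rewrite mul1r mulrCA c1 mulr1 eq_sym.
have -> : (a == s i) = false by apply/eqP => ai; rewrite ai sK eqxx in ti.
by rewrite mul0r rmorph0 mul0r.
Qed.

Lemma ucone_Tlam_one : ucone 1 (Tlam_ker 1).
Proof.
have v1 : isometric (fun i a : 'I_3 => (a == i)%:R * 1 : C).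
  by apply: (isometric_monomial (s := id)) => // i; rewrite rmorph1 mulr1.
apply: (ucone_ext erefl _ (ucone_twirl1 v1)) => a b i j.
rewrite !big_ord_recl !big_ord0 /= !rmorphM !rmorph1 /= !mulr1 !rmorph_nat.
rewrite /Tlam_ker /delta_coef /theta_coef; by field.
Qed.

Definition rot (i a : nat) : int :=
  if i == 0%N then (a == 1)%N%:Z
  else if i == 1%N then - (a == 0)%N%:Z else (a == 2)%N%:Z.

Definition isum (F : nat -> int) : int := F 0%N + F 1%N + F 2%N.

Lemma isumE (F : nat -> int) : \sum_(i < 3) F i = isum F.
Proof. by rewrite (sum_ord3 F). Qed.

Lemma isum2E (F : nat -> nat -> int) :
  \sum_(i : 'I_3 * 'I_3) F i.1 i.2 = isum (fun x => isum (F x)).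
Proof.
rewrite -(pair_bigA _ (fun x y : 'I_3 => F x y)) /= -isumE.
by apply: eq_bigr => x _; rewrite isumE.
Qed.

Lemma conj_int (z : int) : (z%:~R : C)^* = z%:~R.
Proof. exact: rmorph_int. Qed.

Lemma ucone_Tlam_third : ucone 1 (Tlam_ker 3^-1).
Proof.
have v1 : isometric (fun i a : 'I_3 => (rot i a)%:~R : C).
  move=> a b; under eq_bigr => i _ do rewrite conj_int -intrM.
  rewrite -rmorph_sum /= (isumE (fun i => rot i a * rot i b)).
  by case: a => [[|[|[]]]] // ?; case: b => [[|[|[]]]].
apply: (ucone_ext erefl _ (ucone_twirl1 v1)) => a b i j.
under eq_bigr => i' _ do under eq_bigr => a' _ do rewrite conj_int -intrM.
under eq_bigr => i' _ do
  rewrite -rmorph_sum (isumE (fun a' => rot i' a' * rot i' a')).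
rewrite -rmorph_sum (isumE (fun i' => isum (fun a' => rot i' a' * rot i' a'))).
under [X in _ + X * _]eq_bigr => i' _ do under eq_bigr => a' _ do rewrite conj_int -intrM.
under [X in _ + X * _]eq_bigr => i' _ do
  rewrite -rmorph_sum (isumE (fun a' => rot i' a' * rot a' i')).
rewrite -rmorph_sum (isumE (fun i' => isum (fun a' => rot i' a' * rot a' i'))).
have -> : isum (fun i' => isum (fun a' => rot i' a' * rot i' a')) = 3 by vm_compute.
(* This is the trace of the squared rotation, a half turn: -1 - 1 + 1. *)
have -> : isum (fun i' => isum (fun a' => rot i' a' * rot a' i')) = -1 by vm_compute.
by rewrite /Tlam_ker /delta_coef /theta_coef; field.
Qed.

(* Three times the entries of (2/3) sum E_ij (x) E_ij - flip. *)
Definition flip_entry (i1 i2 a1 a2 : nat) : int :=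
  2 * ((i1 == i2) && (a1 == a2))%N%:Z - 3 * ((i1 == a2) && (i2 == a1))%N%:Z.

Definition flip_ker (a b i j : 'I_3 * 'I_3) : C :=
  9 * (delta_coef C a.1 b.1 i.1 j.1 * delta_coef C a.2 b.2 i.2 j.2 +
       theta_coef C a.1 b.1 i.1 j.1 * theta_coef C a.2 b.2 i.2 j.2) -
  23 / 3 * (theta_coef C a.1 b.1 i.1 j.1 * delta_coef C a.2 b.2 i.2 j.2 +
       delta_coef C a.1 b.1 i.1 j.1 * theta_coef C a.2 b.2 i.2 j.2).

Definition isum4 (F : nat -> nat -> nat -> nat -> int) :=
  isum (fun x => isum (fun y => isum (fun z => isum (F x y z)))).

Lemma isum4E (F : nat -> nat -> nat -> nat -> int) :
  \sum_(i : 'I_3 * 'I_3) \sum_(a : 'I_3 * 'I_3) (F i.1 i.2 a.1 a.2)%:~R / 9 =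
  (isum4 F)%:~R / 9 :> C.
Proof.
under eq_bigr => i _ do rewrite -mulr_suml -rmorph_sum /= (isum2E (F i.1 i.2)).
by rewrite -mulr_suml -rmorph_sum /= (isum2E (fun x y => isum (fun z => isum (F x y z)))).
Qed.

(** Write O for the sum of E_ij (x) E_ij and F for the flip. Unitarity follows from O^2 = 3 O, F O =
    O F = O and F^2 = 1. Partial transposition exchanges O and F and full transposition fixes them,
    so the four pairings are 9, -23/3, -23/3, 9. *)
Lemma ucone_flip : ucone 1 flip_ker.
Proof.
have e (x y : int) : (x%:~R / 3)^* * (y%:~R / 3) = (x * y)%:~R / 9 :> C.
  by rewrite rmorphM /= fmorphV rmorph_nat conj_int intrM; field.
have v1 : isometric (fun i a : 'I_3 * 'I_3 => (flip_entry i.1 i.2 a.1 a.2)%:~R / 3 : C).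
  move=> a b; under eq_bigr => i _ do rewrite e.
  rewrite -mulr_suml -rmorph_sum /=
    (isum2E (fun i1 i2 => flip_entry i1 i2 a.1 a.2 * flip_entry i1 i2 b.1 b.2)).
  have -> : isum (fun i1 => isum (fun i2 => flip_entry i1 i2 a.1 a.2 * flip_entry i1 i2 b.1 b.2)) =
      (9 * (a == b))%N%:Z.
    by case: a => [[[|[|[|?]]] ?] [[|[|[|?]]] ?]] //; case: b => [[[|[|[|?]]] ?] [[|[|[|?]]] ?]].
  by rewrite -pmulrn natrM mulrAC divff ?mul1r // pnatr_eq0.
apply: (ucone_ext erefl _ (ucone_twirl2 v1)) => a b i j /=.
under eq_bigr => i' _ do under eq_bigr => a' _ do rewrite e.
under [X in _ + X * _ + _ + _]eq_bigr => i' _ do under eq_bigr => a' _ do rewrite e.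
under [X in _ + X * _ + _]eq_bigr => i' _ do under eq_bigr => a' _ do rewrite e.
under [X in _ + X * _]eq_bigr => i' _ do under eq_bigr => a' _ do rewrite e.
rewrite (isum4E (fun i1 i2 a1 a2 => flip_entry i1 i2 a1 a2 * flip_entry i1 i2 a1 a2)).
rewrite (isum4E (fun i1 i2 a1 a2 => flip_entry i1 i2 a1 a2 * flip_entry a1 i2 i1 a2)).
rewrite (isum4E (fun i1 i2 a1 a2 => flip_entry i1 i2 a1 a2 * flip_entry i1 a2 a1 i2)).
rewrite (isum4E (fun i1 i2 a1 a2 => flip_entry i1 i2 a1 a2 * flip_entry a1 a2 i1 i2)).
have -> : isum4 (fun i1 i2 a1 a2 => flip_entry i1 i2 a1 a2 * flip_entry i1 i2 a1 a2) = 81.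
  by vm_compute.
have -> : isum4 (fun i1 i2 a1 a2 => flip_entry i1 i2 a1 a2 * flip_entry a1 i2 i1 a2) = - 69.
  by vm_compute.
have -> : isum4 (fun i1 i2 a1 a2 => flip_entry i1 i2 a1 a2 * flip_entry i1 a2 a1 i2) = - 69.
  by vm_compute.
have -> : isum4 (fun i1 i2 a1 a2 => flip_entry i1 i2 a1 a2 * flip_entry a1 a2 i1 i2) = 81.
  by vm_compute.
by rewrite /flip_ker; field.
Qed.

(* With the phases [w ^+ n i] chosen in [ucone_cyc], the four partial transposes of
   this monomial matrix sum to zero because 1 + w + w^2 = 0: that kills Sym (x) Sym. *)
Definition cyc (i : 'I_3 * 'I_3) : 'I_3 * 'I_3 :=
  if i.1 == i.2 then (ordS i.1, ordS i.1) else (i.2, i.1).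

Definition cyc_ker (a b i j : 'I_3 * 'I_3) : C :=
  9 * (delta_coef C a.1 b.1 i.1 j.1 * delta_coef C a.2 b.2 i.2 j.2) -
  3 * (theta_coef C a.1 b.1 i.1 j.1 * delta_coef C a.2 b.2 i.2 j.2 +
       delta_coef C a.1 b.1 i.1 j.1 * theta_coef C a.2 b.2 i.2 j.2 +
       theta_coef C a.1 b.1 i.1 j.1 * theta_coef C a.2 b.2 i.2 j.2).

(** The pairing with itself is 9, and each of the other three is 3 (w + w^2) = -3. *)
Lemma ucone_cyc : ucone 1 cyc_ker.
Proof.
have [w [w1 w2]] := cube_root_unity C.
pose n (i : 'I_3 * 'I_3) :=
  if i.1 == i.2 then 0%N else if i.1 == ordS i.2 then 1%N else 2%N.
have v1 : isometric (fun i a : 'I_3 * 'I_3 => (a == cyc i)%:R * w ^+ n i).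
  apply: isometric_monomial; last by move=> i; apply: cube_root_unit.
  by move=> [[[|[|[|?]]] ?] [[|[|[|?]]] ?]] // [[[|[|[|?]]] ?] [[|[|[|?]]] ?]] //;
    move/eqP => // _; apply/eqP.
apply: (ucone_ext erefl _ (ucone_twirl2 v1)) => a b i j /=.
(* Each row has a single nonzero entry, so the sum over [a'] reduces to [cyc i']. *)
have collapse (G : 'I_3 * 'I_3 -> 'I_3 * 'I_3 -> C) :
    \sum_i' \sum_a' ((a' == cyc i')%:R * w ^+ n i')^* * G i' a' =
    \sum_(x < 3) \sum_(y < 3) (w ^+ 2) ^+ n (x, y) * G (x, y) (cyc (x, y)).
  rewrite (pair_bigA _ (fun x y => (w ^+ 2) ^+ n (x, y) * G (x, y) (cyc (x, y)))).
  apply: eq_bigr => -[x y] _ /=.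
  rewrite (bigD1 (cyc (x, y))) //= eqxx mul1r big1 ?addr0 => [|c /negPf ->].
    by rewrite rmorphXn /= w2.
  by rewrite mul0r rmorph0 mul0r.
rewrite (collapse (fun i' a' => (a' == cyc i')%:R * w ^+ n i')).
rewrite (collapse (fun i' a' => ((i'.1, a'.2) == cyc (a'.1, i'.2))%:R * w ^+ n (a'.1, i'.2))).
rewrite (collapse (fun i' a' => ((a'.1, i'.2) == cyc (i'.1, a'.2))%:R * w ^+ n (i'.1, a'.2))).
rewrite (collapse (fun i' a' => (i' == cyc a')%:R * w ^+ n a')).
rewrite !big_ord_recl !big_ord0 /= /n /= !expr0 !expr1.
have w3 : w ^+ 2 = - w - 1 by apply: (addIr (w + 1)); rewrite addrA w1; ring.
by rewrite /cyc_ker; ring: w3.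
Qed.

End Examples.

(** * Tensor powers *)

Section Powers.
Local Open Scope complex_scope.
Variable R : realType.
Local Notation C := R[i].

(** Multi-indices are functions here, so splitting off factors needs no base-3 arithmetic. *)
Definition Tlam_pow_ker (l : C) k (a b i j : {ffun 'I_k -> 'I_3}) : C :=
  \prod_(x < k) Tlam_ker l (a x) (b x) (i x) (j x).

Lemma ucone_Tlam_powD l n m :
  ucone 1 (@Tlam_pow_ker l n) -> ucone 1 (@Tlam_pow_ker l m) ->
  ucone 1 (@Tlam_pow_ker l (n + m)).
Proof.
move=> un um.
pose f (a : {ffun 'I_(n + m) -> 'I_3}) :=
  ([ffun x => a (lshift m x)] : {ffun 'I_n -> 'I_3},
   [ffun x => a (rshift n x)] : {ffun 'I_m -> 'I_3}).
have bf : bijective f.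
  apply: inj_card_bij; last by rewrite card_prod !card_ffun !card_ord expnD.
  move=> a b [/ffunP e1 /ffunP e2]; apply/ffunP => x.
  by case: (split_ordP x) => y ->; [have := e1 y | have := e2 y]; rewrite !ffunE.
apply: (ucone_ext _ _ (ucone_reindex bf (ucone_tensor un um))); first by rewrite mulr1.
move=> a b i j; rewrite /Tlam_pow_ker big_split_ord /=.
by congr (_ * _); apply: eq_bigr => x _; rewrite !ffunE.
Qed.

Lemma ucone_Tlam_pow1 l : ucone 1 (Tlam_ker l) -> ucone 1 (@Tlam_pow_ker l 1).
Proof.
pose f (a : {ffun 'I_1 -> 'I_3}) := a ord0.
have bf : bijective f.
  apply: inj_card_bij; last by rewrite !card_ffun !card_ord.
  by move=> a b e; apply/ffunP => x; rewrite [x]ord1.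
move=> u; apply: (ucone_ext erefl _ (ucone_reindex bf u)) => a b i j.
by rewrite /Tlam_pow_ker big_ord1.
Qed.

Lemma ucone_Tlam_pow2 l :
  ucone 1 (fun a b i j : 'I_3 * 'I_3 =>
    Tlam_ker l a.1 b.1 i.1 j.1 * Tlam_ker l a.2 b.2 i.2 j.2) -> ucone 1 (@Tlam_pow_ker l 2).
Proof.
pose f (a : {ffun 'I_2 -> 'I_3}) := (a ord0, a ord_max).
have bf : bijective f.
  apply: inj_card_bij; last by rewrite card_prod !card_ffun !card_ord.
  move=> a b [e1 e2]; apply/ffunP => -[[|[|//]] h].
    by have -> : Ordinal h = ord0 by apply: val_inj.
  by have -> : Ordinal h = ord_max by apply: val_inj.
move=> u; apply: (ucone_ext erefl _ (ucone_reindex bf u)) => a b i j /=.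
by rewrite /Tlam_pow_ker big_ord_recl big_ord1; do !f_equal; apply: val_inj.
Qed.

Lemma ucone_Tlam_pow3 l :
  ucone 1 (fun a b i j : 'I_3 * ('I_3 * 'I_3) =>
    Tlam_ker l a.1 b.1 i.1 j.1 *
      (Tlam_ker l a.2.1 b.2.1 i.2.1 j.2.1 * Tlam_ker l a.2.2 b.2.2 i.2.2 j.2.2)) ->
  ucone 1 (@Tlam_pow_ker l 3).
Proof.
pose x1 : 'I_3 := lift ord0 ord0.
pose f (a : {ffun 'I_3 -> 'I_3}) := (a ord0, (a x1, a ord_max)).
have bf : bijective f.
  apply: inj_card_bij; last by rewrite !card_prod !card_ffun !card_ord.
  move=> a b [e1 e2 e3]; apply/ffunP => -[[|[|[|//]]] h].
  - by have -> : Ordinal h = ord0 by apply: val_inj.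
  - by have -> : Ordinal h = x1 by apply: val_inj.
  - by have -> : Ordinal h = ord_max by apply: val_inj.
move=> u; apply: (ucone_ext erefl _ (ucone_reindex bf u)) => a b i j /=.
have -> : ord_max = lift ord0 (lift ord0 ord0) :> 'I_3 by apply: val_inj.
by rewrite /Tlam_pow_ker !big_ord_recl big_ord0 mulr1.
Qed.

(** * Convex decompositions of T_l, its square and its cube *)

Lemma ucone_Tlam_large (l : R) : 3^-1 <= l <= 1 -> ucone 1 (Tlam_ker l%:C).
Proof.
move=> /andP[l1 l2].
have p0 : 0 <= ((3 * l - 1) / 2)%:C by rewrite ler0c; lra.
have q0 : 0 <= ((3 - 3 * l) / 2)%:C by rewrite ler0c; lra.
apply: (ucone_ext _ _ (uconeD (uconeZ p0 (ucone_Tlam_one _)) (uconeZ q0 (ucone_Tlam_third _)))).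
  by field.
by move=> a b i j; rewrite /Tlam_ker; field.
Qed.

Lemma ucone_Tlam_two (l : R) : 4^-1 <= l <= 3^-1 ->
  ucone 1 (fun a b i j : 'I_3 * 'I_3 =>
    Tlam_ker l%:C a.1 b.1 i.1 j.1 * Tlam_ker l%:C a.2 b.2 i.2 j.2).
Proof.
move=> /andP[l1 l2].
(* The weights are the unique solution of the three linear equations given by the coefficients of
   W^+W^+, of the mixed products and of W^-W^-. *)
have p0 : 0 <= (9 * (1 - 3 * l) / 7)%:C by rewrite ler0c; lra.
have q0 : 0 <= (9 * l ^+ 2 - 6 * (1 - 3 * l) / 7)%:C by rewrite ler0c; nra.
have r0 : 0 <= ((1 - 3 * l) * (3 * l + 4 / 7))%:C by rewrite ler0c; nra.
have B := ucone_tensor (ucone_Tlam_third C) (ucone_Tlam_third C).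
apply: (ucone_ext _ _ (uconeD (uconeD (uconeZ p0 (ucone_flip _)) (uconeZ q0 B))
  (uconeZ r0 (ucone_cyc _)))).
  by field.
by move=> a b i j; rewrite /flip_ker /cyc_ker /delta_coef /theta_coef /Tlam_ker /=; field.
Qed.

(** Averages over which of the three positions carries the single factor, as the cube of T_l is
    symmetric in its factors. *)
Lemma ucone_sym3 (I : finType)
    (K : I * (I * I) -> I * (I * I) -> I * (I * I) -> I * (I * I) -> C) :
  ucone 1 K -> ucone 1 (fun a b i j =>
    let s1 (x : I * (I * I)) := (x.2.1, (x.1, x.2.2)) in
    let s2 (x : I * (I * I)) := (x.2.2, (x.1, x.2.1)) in
    3^-1 * (K a b i j + K (s1 a) (s1 b) (s1 i) (s1 j) + K (s2 a) (s2 b) (s2 i) (s2 j))).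
Proof.
move=> u; pose s1 (x : I * (I * I)) := (x.2.1, (x.1, x.2.2)).
pose s2 (x : I * (I * I)) := (x.2.2, (x.1, x.2.1)).
have b1 : bijective s1 by exists s1 => -[x [y z]].
have b2 : bijective s2 by exists (fun x => (x.2.1, (x.2.2, x.1))) => -[x [y z]].
have c0 : 0 <= 3^-1 :> C by rewrite invr_ge0 ler0n.
apply: (ucone_ext _ _ (uconeZ c0 (uconeD (uconeD u (ucone_reindex b1 u)) (ucone_reindex b2 u)))).
  by field.
by [].
Qed.

Lemma ucone_Tlam_three (l : R) : 4^-1 <= l <= 3^-1 ->
  ucone 1 (fun a b i j : 'I_3 * ('I_3 * 'I_3) =>
    Tlam_ker l%:C a.1 b.1 i.1 j.1 *
      (Tlam_ker l%:C a.2.1 b.2.1 i.2.1 j.2.1 * Tlam_ker l%:C a.2.2 b.2.2 i.2.2 j.2.2)).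
Proof.
move=> /andP[l1 l2]; pose e := 1 - 3 * l.
have [e0 e1] : 0 <= e /\ e <= 4^-1 by rewrite /e; split; lra.
have el : l = (1 - e) / 3 by rewrite /e; field.
have p0 : 0 <= (9 / 14 * e * (3 + e ^+ 2))%:C by rewrite ler0c; nra.
(* Decreasing in e, with value 3/32 at e = 1/4. *)
have q0 : 0 <= ((1 - e) ^+ 3 - 3 / 7 * e * (3 + e ^+ 2))%:C.
  rewrite ler0c; nra.
have r0 : 0 <= (e * (33 / 14 - 3 * e + 2 / 7 * e ^+ 2))%:C.
  rewrite ler0c; nra.
have s0 : 0 <= (e ^+ 3 / 2)%:C by rewrite ler0c divr_ge0 ?exprn_ge0 // ler0n.
have b := ucone_Tlam_third C.
have BA := ucone_sym3 (ucone_ext (mulr1 1) (fun _ _ _ _ => erefl) (ucone_tensor b (ucone_flip C))).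
have BB := ucone_ext (mulr1 1) (fun _ _ _ _ => erefl) (ucone_tensor b
  (ucone_ext (mulr1 1) (fun _ _ _ _ => erefl) (ucone_tensor b b))).
have BD := ucone_sym3 (ucone_ext (mulr1 1) (fun _ _ _ _ => erefl) (ucone_tensor b (ucone_cyc C))).
have ZD := ucone_sym3 (ucone_ext (mulr1 1) (fun _ _ _ _ => erefl)
  (ucone_tensor (ucone_Tlam_one C) (ucone_cyc C))).
apply: (ucone_ext _ _ (uconeD (uconeD (uconeZ p0 BA) (uconeZ q0 BB))
  (uconeD (uconeZ r0 BD) (uconeZ s0 ZD)))).
  by field.
move=> a b' i j; rewrite el /flip_ker /cyc_ker /delta_coef /theta_coef /Tlam_ker /=.
(* With l written through e, a polynomial identity in e and six atoms remains. *)
set d1 := delta_ker _ a.1 _ _ _; set d2 := delta_ker _ a.2.1 _ _ _;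
set d3 := delta_ker _ a.2.2 _ _ _.
set t1 := theta_ker _ a.1 _ _ _; set t2 := theta_ker _ a.2.1 _ _ _;
set t3 := theta_ker _ a.2.2 _ _ _.
by field.
Qed.

Lemma ucone_Tlam_pow (l : R) k :
  4^-1 <= l -> l <= 1 -> (2 <= k)%N -> ucone 1 (@Tlam_pow_ker l%:C k).
Proof.
move=> l1 l2; have [l3|l3] := lerP 3^-1 l.
  case: k => // k _; elim: k => [|k IH].
    by apply: ucone_Tlam_pow1; apply: ucone_Tlam_large; rewrite l3 l2.
  rewrite -addn1; apply: ucone_Tlam_powD => //.
  by apply: ucone_Tlam_pow1; apply: ucone_Tlam_large; rewrite l3 l2.
have hl : 4^-1 <= l <= 3^-1 by rewrite l1 ltW.
have u2 := ucone_Tlam_pow2 (ucone_Tlam_two hl).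
have u3 := ucone_Tlam_pow3 (ucone_Tlam_three hl).
(* Strong induction in steps of two from the base cases 2 and 3. *)
have [n] := ubnP k; elim: n k => // n IH [|[|[|[|k]]]] // kn _.
rewrite -[k.+4]addn2; apply: ucone_Tlam_powD => //.
by apply: IH => //; apply: ltnW.
Qed.

End Powers.

(** * Return to matrices indexed by base-3 numerals *)

Lemma digit3_inj k : injective (fun a : 'I_(3 ^ k) => [ffun x : 'I_k => digit3 a x]).
Proof.
suff H (a b : nat) : (a < 3 ^ k)%N -> (b < 3 ^ k)%N ->
    (forall x, (x < k)%N -> digit3 a x = digit3 b x) -> a = b.
  move=> a b /ffunP e; apply: val_inj; apply: (H _ _ (ltn_ord a) (ltn_ord b)) => x xk.
  by have := e (Ordinal xk); rewrite !ffunE.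
elim: k a b => [|k IH] a b; first by rewrite expn0 !ltnS !leqn0 => /eqP-> /eqP->.
rewrite expnSr -!ltn_divLR // => ak bk e.
rewrite (divn_eq a 3) (divn_eq b 3); congr (_ * 3 + _)%N.
  (* Dividing by 3 shifts the digits down by one. *)
  apply: IH => // x xk; have := e x.+1 xk.
  by rewrite /digit3 expnS !divnMA.
have /(congr1 val) := e 0%N isT.
by rewrite /digit3 expn0 !divn1 /= !inordK ?ltn_mod.
Qed.

Lemma in_conv_Aut_ucone (R : realType) m (K : 'I_m -> 'I_m -> 'I_m -> 'I_m -> R[i])
    (Phi : 'M[R[i]]_m -> 'M[R[i]]_m) :
  ucone 1 K ->
  (forall X, Phi X = \matrix_(a, b) \sum_i \sum_j K a b i j * X i j) ->
  in_conv_Aut m Phi.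
Proof.
move=> [T [p [u [p0 p1 uu eK]]]] ePhi.
(* A nonnegative element of [R[i]] has zero imaginary part, so real parts serve as weights. *)
have pE t : ((@complex.Re R (p t))%:C)%C = p t.
  by case: (p t) (p0 t) => x y; rewrite lecE /= => /andP[/eqP-> _].
exists #|T|, (fun t => @complex.Re R (p (enum_val t))),
  (fun t => \matrix_(i, j) u (enum_val t) i j).
split.
- by move=> t; have := p0 (enum_val t); rewrite lecE => /andP[].
- apply: (@complexI R); rewrite rmorph_sum /= rmorph1 -p1.
  rewrite [RHS](reindex (@enum_val T xpredT)) /=; last exact: onW_bij (enum_val_bij _).
  by apply: eq_bigr => t _; rewrite pE.
(* [unitarymx] asks for orthonormal rows, [isometric] for orthonormal columns; for square matrices
   one gives the other. *)
- move=> t; apply/unitarymxP; apply: mulmx1C; apply/matrixP => a b.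
  by rewrite !mxE -[RHS](uu (enum_val t) a b); apply: eq_bigr => i _; rewrite !mxE.
- move=> X; rewrite ePhi; apply/matrixP => a b; rewrite summxE mxE.
  under eq_bigr => i _ do under eq_bigr => j _ do rewrite eK mulr_suml.
  under eq_bigr => i _ do rewrite exchange_big.
  rewrite exchange_big /= [LHS](reindex (@enum_val T xpredT)) /=; last first.
    exact: onW_bij (enum_val_bij _).
  apply: eq_bigr => t _; rewrite mxE pE mxE exchange_big mulr_sumr.
  apply: eq_bigr => j _; rewrite !mxE mulr_suml mulr_sumr; apply: eq_bigr => i _.
  by rewrite !mxE /=; ring.
Qed.

Lemma Tlam_delta (R : realType) (l : R) (i j a b : 'I_3) :
  Tlam l (delta_mx i j) a b = Tlam_ker (l%:C)%C a b i j.
Proof.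
rewrite /Tlam /W3p /W3m mxE [X in X + _]mxE [X in _ + X]mxE !mxE /Tlam_ker /delta_ker /theta_ker.
have -> : \tr (delta_mx i j : 'M[R[i]]_3) = (i == j)%:R.
  rewrite /mxtrace (bigD1 i) //= mxE eqxx big1 ?addr0 // => x /negPf xi.
  by rewrite mxE xi.
rewrite (eq_sym b i) andbC.
by case: (i == j) (a == b) (i == b) (a == j) => -[] [] [] /=; field.
Qed.

Theorem theorem6p1 (R : realType) (l : R) (k : nat) :
  4%:R^-1 <= l -> l <= 1 -> (2 <= k)%N ->
  in_conv_Aut (3 ^ k) (tensor_pow (@Tlam R l) k).
Proof.
move=> l1 l2 k2; pose f (a : 'I_(3 ^ k)) := [ffun x : 'I_k => digit3 a x].
have bf : bijective f.
  by apply: inj_card_bij; [exact: digit3_inj | rewrite card_ffun !card_ord].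
apply: (in_conv_Aut_ucone (ucone_reindex bf (ucone_Tlam_pow l1 l2 k2))) => X.
apply/matrixP => a b; rewrite !mxE; apply: eq_bigr => i _; apply: eq_bigr => j _.
by congr (_ * _); apply: eq_bigr => x _; rewrite !ffunE Tlam_delta.
Qed.
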